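(* For every integer $p\ge1$: $$\max\langle c,p\rangle=\max\langle b,P(a,p)+1\rangle,\qquad \min\langle b,P(a,p)+1\rangle=\max\langle a,P(b,p)+1\rangle+1,$$ $$\min\langle c,p\rangle+1=\min\langle a,P(b,p)+1\rangle,\qquad \max\langle b,p\rangle=\max\langle a,P(a,p)+1\rangle .$$
   Context: The Tribonacci sequence $\mathbb{T}$ is the infinite word over $\{a,b,c\}$ that is the fixed point beginning with $a$ of the morphism $\tau(a)=ab$, $\tau(b)=ac$, $\tau(c)=a$; positions are numbered from $1$. Put $T_{-1}=c$ and $T_m=\tau^m(a)$ for $m\ge0$, and let $\delta_m$ be the last letter of $T_m$ ($m\ge-1$). The kernel numbers are $k_0=0$, $k_1=k_2=1$, $k_m=k_{m-1}+k_{m-2}+k_{m-3}-1$ for $m\ge3$. The kernel words are $K_1=a$, $K_2=b$, $K_3=c$, and $K_m=\delta_{m-1}T_{m-3}[1,k_m-1]$ for $m\ge4$, where $\rho[i,j]$ denotes the subword of $\rho$ from position $i$ to position $j$; e.g. $K_4=aa$, $K_5=bab$. For a nonempty factor $\omega$ of $\mathbb{T}$, $Ker(\omega)$ is the maximal kernel word occurring in $\omega$, i.e. the $K_m$ of largest index $m$ that is a factor of $\omega$. For a factor $\omega$ and $p\ge1$, $P(\omega,p)$ is the position of the last letter of the $p$-th occurrence of $\omega$ in $\mathbb{T}$. $\mathcal{P}_T$ is the set of nonempty palindromes occurring as factors of $\mathbb{T}$. For $m,p\ge1$, $\langle K_m,p\rangle=\{P(\omega,p):\omega\in\mathcal{P}_T,\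 Ker(\omega)=K_m\}$ (a finite nonempty set); in particular $\langle a,p\rangle=\langle K_1,p\rangle$, $\langle b,p\rangle=\langle K_2,p\rangle$, $\langle c,p\rangle=\langle K_3,p\rangle$. *)

(* Defs.v *)
From HB Require Import structures.
From mathcomp Require Import all_boot.
From mathcomp Require Import zify.
From mathcomp Require Import boolp classical_sets.
Set Implicit Arguments.
Unset Strict Implicit.
Unset Printing Implicit Defensive.

Local Open Scope nat_scope.

Inductive letter := a | b | c.

Definition letter_eqb (x y : letter) : bool :=
  match x, y with a, a | b, b | c, c => true | _, _ => false end.

Lemma letter_eqP : Equality.axiom letter_eqb.
Proof. by case; case; constructor. Qed.

HB.instance Definition _ := hasDecEq.Build letter letter_eqP.

Definition tau (x : letter) : seq letter :=
  match x with a => [:: a; b] | b => [:: a; c] | c => [:: a] end.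

Definition tauw (w : seq letter) : seq letter := flatten (map tau w).

Definition Tw (m : nat) : seq letter := iter m tauw [:: a].

(* Letter of the Tribonacci sequence at position i, for i >= 1.  The words Tw m
   extend each other and i < size (Tw i), so this is the limit word;
   trib_fixed below says that it is fixed by the morphism. *)
Definition trib (i : nat) : letter := nth a (Tw i) i.-1.

Definition tseg (i l : nat) : seq letter := map trib (iota i l).

(* An occurrence of w in the Tribonacci sequence is identified by the position
   n of its last letter. *)
Definition ends_at (w : seq letter) (n : nat) : bool :=
  (size w <= n) && (tseg (n - size w).+1 (size w) == w).

Definition factor (w : seq letter) : Prop := exists n, ends_at w n.

Definition pth_occ (w : seq letter) (p n : nat) : Prop :=
  ends_at w n /\ count (ends_at w) (iota 1 n) = p.

(* The default value 0 is never used when w is a factor and p >= 1, see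
   P_spec. *)
Definition P (w : seq letter) (p : nat) : nat :=
  xget 0 [set n | pth_occ w p n]%classic.

Fixpoint kernel_number (m : nat) : nat :=
  match m with
  | 0 => 0
  | 1 | 2 => 1
  | ((m0.+1 as m1).+1 as m2).+1 =>
      kernel_number m2 + kernel_number m1 + kernel_number m0 - 1
  end.

Definition delta (m : nat) : letter := last a (Tw m).

(* Kernel words are indexed from 1; the value at 0 is irrelevant. *)
Definition K (m : nat) : seq letter :=
  match m with
  | 0 => [::]
  | 1 => [:: a]
  | 2 => [:: b]
  | 3 => [:: c]
  | _ => delta (m - 1) :: take (kernel_number m - 1) (Tw (m - 3))
  end.

(* Ker(w) as a relation: u is the K_m of largest index m occurring in w. *)
Definition is_Ker (w u : seq letter) : Prop :=
  exists2 m, 1 <= m &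
    [/\ u = K m, infix (K m) w & forall j, m < j -> ~~ infix (K j) w].

Definition palT (w : seq letter) : Prop :=
  [/\ w <> [::], factor w & rev w = w].

Definition Kset (m p : nat) : set nat :=
  [set n | exists w, [/\ palT w, is_Ker w (K m) & n = P w p]]%classic.

Definition is_max (A : set nat) (n : nat) : Prop :=
  A n /\ forall k, A k -> k <= n.

Definition is_min (A : set nat) (n : nat) : Prop :=
  A n /\ forall k, A k -> n <= k.

Lemma tauw_cat u v : tauw (u ++ v) = tauw u ++ tauw v.
Proof. by rewrite /tauw map_cat flatten_cat. Qed.

Lemma TwS m : Tw m.+1 = tauw (Tw m). Proof. by []. Qed.

Lemma Tw_ext m : exists x s, Tw m.+1 = Tw m ++ x :: s.
Proof.
elim: m => [|m [x [s IH]]]; first by exists b, [::].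
exists a, (behead (tauw (x :: s))).
have tx : a :: behead (tauw (x :: s)) = tauw (x :: s) by case: x {IH}.
by rewrite tx TwS {1}IH tauw_cat.
Qed.

Lemma Tw_ext_a m : exists s, Tw m.+2 = Tw m.+1 ++ a :: s.
Proof.
have [x [s E]] := Tw_ext m; exists (behead (tauw (x :: s))).
have tx : a :: behead (tauw (x :: s)) = tauw (x :: s) by case: x {E}.
by rewrite tx TwS {1}E tauw_cat.
Qed.

Lemma Tw_prefix m d : exists s, Tw (d + m) = Tw m ++ s.
Proof.
elim: d => [|d [s IH]]; first by exists [::]; rewrite cats0.
have [x [s' E]] := Tw_ext (d + m).
by exists (s ++ x :: s'); rewrite addSn E IH catA.
Qed.

Lemma size_Tw m : m < size (Tw m).
Proof.
elim: m => // m IH; have [x [s ->]] := Tw_ext m.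
by rewrite size_cat addnS ltnS (leq_trans IH) ?leq_addr.
Qed.

Lemma tribE m i : 0 < i <= size (Tw m) -> trib i = nth a (Tw m) i.-1.
Proof.
move=> /andP[i0 im]; rewrite /trib; have := size_Tw i => ii.
have [mi|/ltnW mi] := leqP m i.
  have [s E] := Tw_prefix m (i - m); rewrite subnK // in E.
  by rewrite {1}E nth_cat ifT //; lia.
have [s E] := Tw_prefix i (m - i); rewrite subnK // in E.
by rewrite E nth_cat ifT //; lia.
Qed.

Lemma tseg_Tw m : tseg 1 (size (Tw m)) = Tw m.
Proof.
apply: (@eq_from_nth _ a); rewrite size_map size_iota // => i im.
by rewrite (nth_map 0) ?size_iota // nth_iota // add1n (@tribE m).
Qed.

Lemma take_tseg i l n : n <= l -> take n (tseg i l) = tseg i n.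
Proof. by move=> nl; rewrite /tseg -map_take take_iota (minn_idPl nl). Qed.

Lemma trib1 : trib 1 = a. Proof. by []. Qed.

Lemma trib_fixed n : let w := tauw (tseg 1 n) in w = tseg 1 (size w).
Proof.
move=> w; have nT := ltnW (size_Tw n).
have E : Tw n = tseg 1 n ++ drop n (Tw n).
  by rewrite -(take_tseg 1 nT) tseg_Tw cat_take_drop.
have E1 : Tw n.+1 = w ++ tauw (drop n (Tw n)) by rewrite TwS {1}E tauw_cat.
have sw : size w <= size (Tw n.+1) by rewrite E1 size_cat leq_addr.
by rewrite -(take_tseg 1 sw) tseg_Tw E1 take_size_cat.
Qed.

Lemma ends_at_Tw w m n : n <= size (Tw m) ->
  ends_at w n = (size w <= n) && (take (size w) (drop (n - size w) (Tw m)) == w).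
Proof.
move=> nm; rewrite /ends_at; case: leqP => //= wn; congr (_ == _).
rewrite -tseg_Tw /tseg -map_drop -map_take drop_iota take_iota add1n.
by congr (map _ (iota _ _)); lia.
Qed.

Lemma iter_tauw_cat m u v :
  iter m tauw (u ++ v) = iter m tauw u ++ iter m tauw v.
Proof. by elim: m => //= m ->; rewrite tauw_cat. Qed.

Lemma factor_recurs w N : factor w -> exists2 n, N <= n & ends_at w n.
Proof.
move=> [n wn]; have nT := ltnW (size_Tw n).
move: wn; rewrite (ends_at_Tw _ nT) => /andP[wn /eqP ew].
have [s E] := Tw_ext_a N.
have E1 : Tw (n + N.+2) = Tw (n + N.+1) ++ Tw n ++ iter n tauw s.
  have TwD k : Tw (n + k) = iter n tauw (Tw k) by rewrite /Tw iterD.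
  by rewrite !TwD E -cat1s !iter_tauw_cat.
have sz : n + size (Tw (n + N.+1)) <= size (Tw (n + N.+2)).
  by rewrite E1 !size_cat; lia.
exists (n + size (Tw (n + N.+1))); first by have := size_Tw (n + N.+1); lia.
rewrite (ends_at_Tw _ sz); apply/andP; split; first lia.
rewrite E1 drop_cat ifF; last lia.
have -> : n + size (Tw (n + N.+1)) - size w - size (Tw (n + N.+1)) = n - size w.
  lia.
apply/eqP; rewrite -[RHS]ew drop_cat; case: ifP => h.
  by rewrite takel_cat // size_drop; lia.
have -> : size w = 0 by lia.
by rewrite !take0.
Qed.

Lemma P_spec w p : factor w -> 0 < p -> pth_occ w p (P w p).
Proof.
move=> fw p0; apply: (@xgetPex _ 0 [set n | pth_occ w p n]%classic).
pose ct n := count (ends_at w) (iota 1 n).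
have ctS n : ct n.+1 = ct n + ends_at w n.+1.
  by rewrite /ct -[n.+1]addn1 iotaD count_cat /= addn0 add1n addn1.
have ctD n d : ct n <= ct (d + n).
  by elim: d => // d IH; rewrite addSn ctS; lia.
have ex : exists n, p <= ct n.
  elim: p {p0} => [|p [n pn]]; first by exists 0.
  have [[|n'] nn' wn'] := factor_recurs n.+1 fw; first by [].
  exists n'.+1; rewrite ctS wn'.
  by have := ctD n (n' - n); rewrite subnK //; lia.
case: (ex_minnP ex) => -[|n]; first by rewrite /ct /=; lia.
rewrite ctS => pn mn; have := mn n; exists n.+1.
suff: ends_at w n.+1 /\ ct n.+1 = p by [].
by rewrite ctS; case: (ends_at w n.+1) pn => /=; lia.
Qed.

(* Main.v *)
(** The only palindromic factors with kernel [a] are [a]; with kernel [b] they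
    are [b], [aba]; with kernel [c] they are [c], [aca], [bacab], [abacaba].
    Every [b] (resp. [c]) of the sequence sits in the middle of an occurrence of
    [aba] (resp. [abacaba]), so all the positions involved are [P [:: x] p] up to
    a shift of at most 3.  Finally, [T = tau(T)] makes the position map
    [L n = |tau(T[1,n])|] send the p-th [a] to the p-th [b] and the p-th [b] to
    the p-th [c], and the (n+1)-st [a] is at position [L n + 1]. *)
Require Import Defs.
From mathcomp Require Import all_boot.
From mathcomp Require Import zify.

Set Implicit Arguments.
Unset Strict Implicit.
Unset Printing Implicit Defensive.

(** * Counting occurrences; uniqueness of the p-th one *)

Lemma count_ends_at_mono w m n :
  m <= n -> count (ends_at w) (iota 1 m) <= count (ends_at w) (iota 1 n).
Proof. by move=> mn; rewrite -(subnKC mn) (iotaD 1) count_cat leq_addr. Qed.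

Lemma count_iota1S (f : pred nat) n :
  count f (iota 1 n.+1) = count f (iota 1 n) + f n.+1.
Proof. by rewrite -[X in iota _ X]addn1 (iotaD 1) count_cat /= addn0 add1n. Qed.

(** The count jumps at [m], where [w] ends, so it is strictly below [p] at every smaller
    position. *)
Lemma pth_occ_le w p m n : 0 < p -> pth_occ w p m -> pth_occ w p n -> m <= n.
Proof.
move=> p0 [wm cm] [wn cn]; case: leqP => // nm.
have := @count_ends_at_mono w n m.-1.
case: m wm cm nm => // m wm cm nm /=.
by rewrite count_iota1S wm cn in cm *; lia.
Qed.

Lemma P_unique w p n : 0 < p -> pth_occ w p n -> P w p = n.
Proof.
move=> p0 wn; have fw : factor w by exists n; case: wn.
have wP := P_spec fw p0.
by apply/eqP; rewrite eqn_leq (pth_occ_le p0 wP wn) (pth_occ_le p0 wn wP).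
Qed.

(** Translation by [d] matches the ends of [u] with those of [w], and the last premise rules out
    extra early occurrences of [w], so the p-th ones correspond. *)
Lemma P_shift u w d p : 0 < p -> factor u -> 0 < size u ->
  (forall n, ends_at w (n + d) = ends_at u n) ->
  (forall n, n < d -> ends_at w n = false) -> P w p = P u p + d.
Proof.
move=> p0 fu su wu w0; have [un cn] := P_spec fu p0.
apply: P_unique => //; split; first by rewrite wu.
have u0 : ends_at u 0 = false by rewrite /ends_at; case: (u) su.
(* Position [d] itself is covered by the first premise at 0, where the nonempty [u] cannot end. *)
have cd : count (ends_at w) (iota 1 d) = 0.
  case: d wu w0 => // d wu w0.
  rewrite count_iota1S -[d.+1]add0n wu u0 addn0.
  apply/eqP; rewrite -leqn0 leqNgt -has_count; apply/hasPn => i.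
  by rewrite mem_iota => h; rewrite w0 //; lia.
rewrite addnC iotaD count_cat cd -[RHS]cn add0n.
rewrite [1 + d]addnC iotaDl count_map; apply: eq_count => i /=.
by rewrite addnC wu.
Qed.

(** * Blocks of the morphism and positions of single letters *)

Lemma tsegS i l : tseg i l.+1 = trib i :: tseg i.+1 l.
Proof. by []. Qed.

Lemma tseg1S n : tseg 1 n.+1 = rcons (tseg 1 n) (trib n.+1).
Proof. by rewrite /tseg -cats1 -[n.+1]addn1 iotaD map_cat /= addn1. Qed.

Lemma ends_at1 x n : ends_at [:: x] n = (0 < n) && (trib n == x).
Proof.
by rewrite /ends_at /=; case: n => //= n; rewrite subn1 /tseg /= eqseq_cons andbT.
Qed.

Lemma count_ends_at1 x n :
  count (ends_at [:: x]) (iota 1 n) = count_mem x (tseg 1 n).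
Proof.
rewrite count_map; apply: eq_in_count => i; rewrite mem_iota => /andP[i0 _].
by rewrite ends_at1 /= i0.
Qed.

Definition L (n : nat) : nat := size (tauw (tseg 1 n)).

Lemma tseg_L n : tseg 1 (L n) = tauw (tseg 1 n).
Proof. by rewrite [RHS]trib_fixed. Qed.

Lemma L_S n : L n.+1 = L n + size (tau (trib n.+1)).
Proof. by rewrite /L tseg1S -cats1 tauw_cat size_cat /tauw /= cats0. Qed.

Lemma nth_tseg i l k : k < l -> nth a (tseg i l) k = trib (i + k).
Proof. by move=> kl; rewrite (nth_map 0) ?size_iota // nth_iota. Qed.

(** The block [tau (trib n.+1)] fills the positions from [L n + 1] to [L n.+1]. *)
Lemma trib_L n k : k < size (tau (trib n.+1)) ->
  trib (L n + k.+1) = nth a (tau (trib n.+1)) k.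
Proof.
move=> h; have := tseg_L n.+1; rewrite tseg1S -cats1 tauw_cat -tseg_L.
move/(congr1 (fun s => nth a s (L n + k))).
rewrite nth_tseg ?L_S ?ltn_add2l // nth_cat size_map size_iota ifF; last by lia.
by rewrite addKn /tauw /= cats0 add1n addnS.
Qed.

Lemma trib_L1 n : trib (L n).+1 = a.
Proof. by rewrite -addn1 trib_L; case: (trib n.+1). Qed.

Lemma count_tauw_a u : count_mem a (tauw u) = size u.
Proof. by elim: u => // x u IH; rewrite -cat1s tauw_cat count_cat IH; case: x. Qed.

Lemma count_tauw_b u : count_mem b (tauw u) = count_mem a u.
Proof. by elim: u => // x u IH; rewrite -cat1s tauw_cat count_cat IH; case: x. Qed.

Lemma count_tauw_c u : count_mem c (tauw u) = count_mem b u.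
Proof. by elim: u => // x u IH; rewrite -cat1s tauw_cat count_cat IH; case: x. Qed.

Lemma factor1 x : factor [:: x].
Proof. by case: x; [exists 1 | exists 2 | exists 4]. Qed.

Lemma P1_spec x p : 0 < p ->
  [/\ 0 < P [:: x] p, trib (P [:: x] p) = x &
      count_mem x (tseg 1 (P [:: x] p)) = p].
Proof.
by move=> /(P_spec (factor1 x)) []; rewrite ends_at1 count_ends_at1 => /andP[? /eqP].
Qed.

Lemma P1_unique x p n : 0 < p -> 0 < n -> trib n = x ->
  count_mem x (tseg 1 n) = p -> P [:: x] p = n.
Proof.
move=> p0 n0 xn cn; apply: P_unique => //; split.
  by rewrite ends_at1 n0 xn eqxx.
by rewrite count_ends_at1.
Qed.

(** Each block contains exactly one [a], its first letter, so the block of index [n + 1] opens with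
    the [a] of that number. *)
Lemma P_a_S n : P [:: a] (n + 1) = L n + 1.
Proof.
rewrite !addn1; apply: P1_unique => //; first exact: trib_L1.
rewrite tseg1S trib_L1 -cats1 count_cat tseg_L count_tauw_a size_map size_iota.
by rewrite /= addn1.
Qed.

(** A [b] arises only as the last letter of the block of an [a], one for each [a]; likewise each [c]
    ends the block of a [b]. *)
Lemma P_b_L p : 0 < p -> P [:: b] p = L (P [:: a] p).
Proof.
move=> p0; have [] := P1_spec a p0; case: (P [:: a] p) => // n _ an cn.
apply: P1_unique => //.
  by rewrite L_S an trib_L an.
by rewrite tseg_L count_tauw_b.
Qed.

Lemma P_c_L p : 0 < p -> P [:: c] p = L (P [:: b] p).
Proof.
move=> p0; have [] := P1_spec b p0; case: (P [:: b] p) => // n _ an cn.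
apply: P1_unique => //.
  by rewrite L_S an trib_L an.
by rewrite tseg_L count_tauw_c.
Qed.

(** The [a] numbered [P [:: a] p + 1] directly follows the p-th [b]. The block of that [b] ends at
    the p-th [c], and the next block [ab] ends two places later. *)
Lemma P_b_S p : 0 < p -> P [:: b] (P [:: a] p + 1) = P [:: c] p + 2.
Proof.
move=> p0; rewrite P_b_L ?addn1 // -addn1 P_a_S -P_b_L // addn1 L_S.
by rewrite -P_c_L // P_b_L // trib_L1.
Qed.

(** * Neighbourhoods of the letters b and c *)

Lemma L_block n : 0 < n -> exists m,
  n = (L m).+1 \/ [/\ n = (L m).+2, n = L m.+1 & trib n = nth a (tau (trib m.+1)) 1].
Proof.
elim: n => // -[_ _|n IH _]; first by exists 0; left.
have [m [->|[-> E _]]] := IH isT; last by exists m.+1; left; rewrite -E.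
case E : (size (tau (trib m.+1))) => [|[|[|k]]]; try by case: (trib m.+1) E.
  by exists m.+1; left; rewrite L_S E addn1.
exists m; right; split => //; first by rewrite L_S E addn2.
by rewrite -addn2 trib_L ?E.
Qed.

(** Every block opens with [a], so any other letter is the second, hence last, letter of its
    block. *)
Lemma trib_nona n : trib n <> a -> exists m,
  [/\ n = (L m).+2, n = L m.+1 & trib n = nth a (tau (trib m.+1)) 1].
Proof.
case: n => // n na; have [m [E|]] := @L_block n.+1 isT; last by exists m.
by rewrite E trib_L1 in na.
Qed.

Lemma trib_around_nona n : trib n <> a ->
  [/\ 1 < n, trib n.-1 = a & trib n.+1 = a].
Proof.
case/trib_nona => m [-> E _]; split => //=; first exact: trib_L1.
by rewrite E trib_L1.
Qed.

(** A [c] ends the block of a [b], whose neighbours are both [a]; applying [tau] to [aba] and adding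
    the [a] that opens the next block gives [abacaba]. *)
Lemma trib_around_c n : trib n = c ->
  3 < n /\ tseg (n - 3) 7 = [:: a; b; a; c; a; b; a].
Proof.
move=> cn; have [|m [E1 E2 E3]] := @trib_nona n; first by rewrite cn.
have bm : trib m.+1 = b by move: E3; rewrite cn; case: (trib m.+1).
have [|m1 am am2] := @trib_around_nona m.+1; first by rewrite bm.
case: m E1 E2 E3 bm m1 am am2 => // m E1 E2 E3 bm _ /= am am2.
(* The [b] now sits at [m.+2]: the blocks of [m.+1], [m.+2], [m.+3] and one further letter fill
   positions [n - 3] to [n + 3]. *)
have Lm : L m.+1 = L m + 2 by rewrite L_S am.
have Lm2 : L m.+3 = n + 2 by rewrite L_S am2 E2.
have t1 := trib_L1 m; have t3 := trib_L1 m.+1.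
have t5 := trib_L1 m.+2; have t7 := trib_L1 m.+3.
have t2 : trib (L m + 2) = b by rewrite trib_L am.
have t6 : trib (L m.+2 + 2) = b by rewrite trib_L am2.
rewrite -E2 in t5 t6; rewrite Lm2 addn2 in t7; rewrite addn2 in t6.
rewrite Lm addn2 in t3 E1; rewrite addn2 in t2.
split; first by lia.
have -> : n - 3 = (L m).+1 by lia.
by rewrite 7!tsegS -E1 t1 t2 t3 cn t5 t6 t7.
Qed.

(** * End positions of aba, aca, bacab and abacaba *)

Lemma ends_atP w n : reflect (exists2 k, n = k + size w & tseg k.+1 (size w) = w)
                             (ends_at w n).
Proof.
apply: (iffP andP) => [[wn /eqP E]|[k -> E]].
  by exists (n - size w) => //; rewrite subnK.
by rewrite leq_addl addnK E.
Qed.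

(** When every [x] is forced to have [l] before it and [r] after it, occurrences of the long word
    and of [x] correspond, with ends [size r] apart. *)
Lemma P_extend x l r p : 0 < p ->
  (forall n, trib n = x ->
     size l < n /\ tseg (n - size l) (size (l ++ x :: r)) = l ++ x :: r) ->
  P (l ++ x :: r) p = P [:: x] p + size r.
Proof.
move=> p0 H; set w := l ++ x :: r.
have sw : size w = size l + (size r).+1 by rewrite size_cat.
have wx k : tseg k.+1 (size w) = w -> trib (k + (size l).+1) = x.
  move=> /(congr1 (fun s => nth a s (size l))).
  rewrite nth_tseg ?sw; last by lia.
  by rewrite /w nth_cat ltnn subnn /= addSnnS.
apply: P_shift => //; first exact: factor1.
- move=> n; rewrite ends_at1; apply/ends_atP/andP => [[k E tk]|[n0 /eqP xn]].
    rewrite sw in E; have -> : n = k + (size l).+1 by lia.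
    by rewrite wx // eqxx addnS.
  have [ln tn] := H _ xn; exists (n - size l).-1; first by rewrite sw; lia.
  by rewrite -/w in tn; rewrite prednK //; lia.
- by move=> n nr; rewrite /ends_at sw; apply/negbTE; rewrite negb_and; lia.
Qed.

Lemma P_aba p : 0 < p -> P [:: a; b; a] p = P [:: b] p + 1.
Proof.
move=> p0; apply: (@P_extend b [:: a] [:: a]) => // n bn.
have [|n1 an an1] := @trib_around_nona n; first by rewrite bn.
case: n bn n1 an an1 => //= n bn n1 an an1; split => //.
by rewrite subn1 /= 3!tsegS an bn an1.
Qed.

Lemma P_aca p : 0 < p -> P [:: a; c; a] p = P [:: c] p + 1.
Proof.
move=> p0; apply: (@P_extend c [:: a] [:: a]) => // n /trib_around_c [n3 E].
split; first by rewrite /=; lia.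
move: E; have -> : n - 3 = n.-2.-1 by lia.
case: n n3 => [|[|[|n]]] //= _ [_ _ E1 E2 E3 _ _].
by rewrite subn1 /= 3!tsegS E1 E2 E3.
Qed.

Lemma P_bacab p : 0 < p -> P [:: b; a; c; a; b] p = P [:: c] p + 2.
Proof.
move=> p0.
apply: (@P_extend c [:: b; a] [:: a; b]) => // n /trib_around_c [n3 E].
split; first by rewrite /=; lia.
move: E; have -> : n - 3 = n.-2.-1 by lia.
case: n n3 => [|[|[|n]]] //= _ [_ E0 E1 E2 E3 E4 _].
by rewrite subn2 /= 5!tsegS E0 E1 E2 E3 E4.
Qed.

Lemma P_abacaba p : 0 < p -> P [:: a; b; a; c; a; b; a] p = P [:: c] p + 3.
Proof.
move=> p0.
by apply: (@P_extend c [:: a; b; a] [:: a; b; a]) => // n /trib_around_c [].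
Qed.

(** * Palindromes without long kernel words *)

Lemma factor_infix u w : infix u w -> factor w -> factor u.
Proof.
case/infixP => s [t ->] [_ /ends_atP[k _ E]].
exists (k + size s + size u); apply/ends_atP; exists (k + size s) => //.
move: E; rewrite /tseg !size_cat iotaD map_cat iotaD map_cat => /eqP.
rewrite eqseq_cat ?size_map ?size_iota // => /andP[_].
rewrite eqseq_cat ?size_map ?size_iota // => /andP[/eqP E _].
by rewrite -[RHS]E addSn.
Qed.

Lemma not_factor_nona x y : x != a -> y != a -> ~ factor [:: x; y].
Proof.
move=> xa ya [_ /ends_atP[k _ [Ex Ey]]].
have [|_ _ Ea] := @trib_around_nona k.+1; first by rewrite Ex; exact/eqP.
by rewrite -Ey Ea in ya.
Qed.

Lemma not_factor_cac : ~ factor [:: c; a; c].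
Proof.
move=> [_ /ends_atP[k _ [Ec _ Ec2]]].
have [k3] := trib_around_c Ec; have -> : k.+1 - 3 = k.-2 by lia.
by case: k k3 Ec Ec2 => [|[|k]] //= _ _ Ec2 [_ _ _ _ _ E _]; rewrite E in Ec2.
Qed.

(** Together with [K 4], [K 5] and [K 6], avoiding these words is enough to confine palindromes to
    [small_pals]. *)
Definition nonfactors : seq (seq letter) :=
  [:: [:: b; b]; [:: b; c]; [:: c; b]; [:: c; c]; [:: c; a; c]].

Lemma nonfactorsP u : u \in nonfactors -> ~ factor u.
Proof.
by rewrite !inE => /or4P[||| /orP[]] /eqP ->;
   first [exact: not_factor_nona | exact: not_factor_cac].
Qed.

Definition small_pals : seq (seq letter) :=
  [:: [:: a]; [:: b]; [:: a; b; a]; [:: c]; [:: a; c; a]; [:: b; a; c; a; b];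
      [:: a; b; a; c; a; b; a]].

(* Stripping both end letters leaves a smaller such palindrome or the empty word,
   so only the extensions [x u x] of the listed words [u] have to be checked. *)
Lemma pal_small w : w <> [::] -> rev w = w ->
  all (fun u => ~~ infix u w) (nonfactors ++ [:: K 4; K 5; K 6]) ->
  w \in small_pals.
Proof.
have [n] := ubnP (size w); elim: n w => // n IH [|x w] // sw _.
case/lastP: w sw => [|w y] sw; first by case: x {sw}.
rewrite rev_cons rev_rcons => -[-> /rcons_inj[rw]] av.
have av' : all (fun u => ~~ infix u w) (nonfactors ++ [:: K 4; K 5; K 6]).
  apply/allP => u ul; move/allP: av => av; move: (av u ul); apply: contra.
  move=> /infix_trans; apply.
  by rewrite -cats1; exact: (infix_infix [:: x]).
have : w \in [::] :: small_pals.
  rewrite inE; case: (eqVneq w [::]) => //= /eqP w0; apply: IH => //.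
  by rewrite /= size_rcons !ltnS in sw; exact: ltnW.
move: av; rewrite !inE => av /or4P[||| /or4P[|||/orP[]]] /eqP ew; subst w.
all: by case: x av {sw}; vm_compute.
Qed.

(** * Lengths of kernel words *)

Lemma kernel_numberS m : 0 < m ->
  0 < kernel_number m /\ kernel_number m <= kernel_number m.+1.
Proof.
elim/ltn_ind: m => -[//|[//|[//|m]]] IH _.
have [h1 h2] := IH m.+1 ltac:(lia) isT.
have [h3 h4] := IH m.+2 ltac:(lia) isT.
have E k : kernel_number k.+3 =
    kernel_number k.+2 + kernel_number k.+1 + kernel_number k - 1 by [].
(* A positive summand absorbs the [- 1]; hence positivity is part of the induction. *)
rewrite (E m.+1) (E m); lia.
Qed.

Lemma kernel_number_mono m n :
  0 < m -> m <= n -> kernel_number m <= kernel_number n.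
Proof.
move=> m0 /subnK <-; elim: (n - m) => // d IH.
by apply: (leq_trans IH); rewrite addSn; case: (@kernel_numberS (d + m)); lia.
Qed.

Lemma size_Tw_mono m n : m <= n -> size (Tw m) <= size (Tw n).
Proof.
by move=> /subnK <-; have [s ->] := Tw_prefix m (n - m); rewrite size_cat leq_addr.
Qed.

Lemma size_K_mono m n : 3 < m -> m <= n -> size (K m) <= size (K n).
Proof.
have E k : size (K k.+4) = (minn (kernel_number k.+4).-1 (size (Tw k.+1))).+1.
  by rewrite /= size_take_min !subn1.
case: m => [|[|[|[|m]]]] //; case: n => [|[|[|[|n]]]] // _ mn; rewrite !E.
have := @kernel_number_mono m.+4 n.+4 isT mn; have := @size_Tw_mono m.+1 n.+1; lia.
Qed.

(** The first three kernel words are distinct letters and all later ones have at least two letters.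
    This recovers the index from the word in [is_Ker]. *)
Lemma K_inj3 m n : 0 < m <= 3 -> 0 < n -> K m = K n -> m = n.
Proof.
move=> m3 n0 E; have [n3|n4] := leqP n 3.
  by case: m m3 E => [|[|[|[|m]]]] //; case: n n0 n3 => [|[|[|[|n]]]].
have := @size_K_mono 4 n isT n4; rewrite -E.
by case: m m3 {E} => [|[|[|[|m]]]].
Qed.

(** * The sets [Kset m p] for the kernels a, b, c *)

Lemma is_KerP m w : 0 < m <= 3 ->
  is_Ker w (K m) <-> infix (K m) w /\ forall j, m < j -> ~~ infix (K j) w.
Proof.
move=> m3; split=> [[n n0 [E i H]]|[i H]]; last by exists m => //; lia.
by rewrite (K_inj3 m3 n0 E).
Qed.

Lemma palT_small w m : 0 < m <= 3 -> palT w -> is_Ker w (K m) ->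
  w \in small_pals.
Proof.
move=> m3 [w0 fw rw] /(is_KerP _ m3) [_ H]; apply: pal_small => //.
apply/allP => u; rewrite mem_cat => /orP[/nonfactorsP nu|].
  by apply/negP => /factor_infix /(_ fw).
by rewrite !inE => /or3P[] /eqP ->; apply: H; lia.
Qed.

(** From [K 7] on, kernel words are longer than the 7 letters of the longest small palindrome; [K 4]
    to [K 6] are checked by computation. *)
Lemma small_infix_KP w m : 0 < m -> w \in small_pals ->
  infix (K m) w -> m <= 3.
Proof.
move=> m0 sw iw; rewrite leqNgt; apply/negP => m4.
have [m7|m7] := leqP 7 m.
  have sw7 : size w <= 7.
    by move: sw; rewrite !inE => /or4P[|||/or4P[]] /eqP ->.
  have := leq_trans (leq_trans (@size_K_mono 7 m isT m7) (size_infix iw)) sw7.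
  by vm_compute.
by move: m m4 m7 iw {m0} => [|[|[|[|[|[|[|m]]]]]]] // _ _; apply/negP;
   move: sw; rewrite !inE => /or4P[|||/or4P[]] /eqP ->; vm_compute.
Qed.

(** A computable form of the kernel condition: inside small palindromes only the indices 2 and 3 can
    exceed a positive [m]. *)
Definition kernel_pals (m : nat) : seq (seq letter) :=
  [seq w <- small_pals | infix (K m) w &
                         all (fun j => (m < j) ==> ~~ infix (K j) w) [:: 2; 3]].

Lemma kernel_pals1 : kernel_pals 1 = [:: [:: a]].
Proof. by vm_compute. Qed.

Lemma kernel_pals2 : kernel_pals 2 = [:: [:: b]; [:: a; b; a]].
Proof. by vm_compute. Qed.

Lemma kernel_pals3 : kernel_pals 3 =
  [:: [:: c]; [:: a; c; a]; [:: b; a; c; a; b]; [:: a; b; a; c; a; b; a]].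
Proof. by vm_compute. Qed.

(** All of them occur in [abacaba], the prefix of length 7 of the sequence. *)
Lemma small_palT w : w \in small_pals -> palT w.
Proof.
move=> sw; split; try by move: sw; rewrite !inE => /or4P[|||/or4P[]] /eqP ->.
apply: (@factor_infix _ [:: a; b; a; c; a; b; a]); last by exists 7; vm_compute.
by move: sw; rewrite !inE => /or4P[|||/or4P[]] /eqP ->; vm_compute.
Qed.

Lemma KsetP m p n : 0 < m <= 3 ->
  Kset m p n <-> exists2 w, w \in kernel_pals m & n = P w p.
Proof.
move=> m3; split=> [[w [pw kw ->]]|[w]].
  exists w => //; rewrite mem_filter (palT_small m3 pw kw) andbT.
  have [-> H] := (is_KerP w m3).1 kw.
  by apply/allP => j _; apply/implyP => /H.
rewrite mem_filter => /andP[/andP[iw /allP H] sw] ->.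
exists w; split => //; first exact: small_palT.
apply/(is_KerP _ m3); split => // j mj; apply/negP => ij.
have j0 : 0 < j by lia.
have j3 := small_infix_KP j0 sw ij.
have : j \in [:: 2; 3] by rewrite !inE; lia.
by move/H; rewrite mj ij.
Qed.

Lemma Kset1P p n : Kset 1 p n <-> n = P [:: a] p.
Proof.
rewrite KsetP // kernel_pals1; split=> [[w]|->]; first by rewrite inE => /eqP ->.
by exists [:: a].
Qed.

Lemma Kset2P p n : 0 < p ->
  Kset 2 p n <-> n = P [:: b] p \/ n = P [:: b] p + 1.
Proof.
move=> p0; rewrite KsetP // kernel_pals2 -P_aba //.
split=> [[w]|]; first by rewrite !inE => /orP[] /eqP ->; [left|right].
by case=> ->; [exists [:: b] | exists [:: a; b; a]].
Qed.

Lemma Kset3P p n : 0 < p ->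
  Kset 3 p n <-> P [:: c] p <= n <= P [:: c] p + 3.
Proof.
move=> p0; rewrite KsetP // kernel_pals3; split=> [[w]|h].
  by rewrite !inE => /or4P[] /eqP -> ->;
     rewrite ?P_aca ?P_bacab ?P_abacaba //; lia.
have : n = P [:: c] p \/ n = P [:: c] p + 1 \/ n = P [:: c] p + 2
    \/ n = P [:: c] p + 3 by lia.
rewrite -P_aca // -P_bacab // -P_abacaba //.
by case=> [|[|[]]] ->; [exists [:: c] | exists [:: a; c; a] |
  exists [:: b; a; c; a; b] | exists [:: a; b; a; c; a; b; a]].
Qed.

Theorem mainTheorem10 (p : nat) (hp : 1 <= p) :
  [/\ exists M, is_max (Kset 3 p) M /\ is_max (Kset 2 (P [:: a] p + 1)) M,
      exists M, is_max (Kset 1 (P [:: b] p + 1)) M /\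
                is_min (Kset 2 (P [:: a] p + 1)) (M + 1),
      exists m, is_min (Kset 3 p) m /\
                is_min (Kset 1 (P [:: b] p + 1)) (m + 1) &
      exists M, is_max (Kset 2 p) M /\ is_max (Kset 1 (P [:: a] p + 1)) M].
Proof.
(* The [a] numbered [n + 1] lies just after [L n]: right after the p-th [c] for [n = P [:: b] p],
   right after the p-th [b] for [n = P [:: a] p]. *)
have K1b n : Kset 1 (P [:: b] p + 1) n <-> n = P [:: c] p + 1.
  by rewrite Kset1P P_a_S -P_c_L.
have K1a n : Kset 1 (P [:: a] p + 1) n <-> n = P [:: b] p + 1.
  by rewrite Kset1P P_a_S -P_b_L.
have K2 n : Kset 2 (P [:: a] p + 1) n <->
    n = P [:: c] p + 2 \/ n = P [:: c] p + 3.
  by rewrite Kset2P ?P_b_S -?addnA // addn1.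
have K2p n := Kset2P n hp.
have K3 n := Kset3P n hp.
(* The witnesses are read off from the explicit sets above. *)
split; [exists (P [:: c] p + 3) | exists (P [:: c] p + 1) | exists (P [:: c] p)
       | exists (P [:: b] p + 1)]; do 2 split.
all: by [apply/K3; lia | apply/K2; lia | apply/K1a; lia | apply/K1b; lia
        | apply/K2p; lia | move=> k /K3; lia | move=> k /K2; lia
        | move=> k /K1a; lia | move=> k /K1b; lia | move=> k /K2p; lia].
Qed.
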